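(* Let $(X,d)$ be a complete Busemann space, let $H:[0,\infty)\to\mathbb{R}$ be continuous and non-decreasing, and let $u_0:X\to\mathbb{R}$ be Lipschitz continuous. Let $u\in C(X\times[0,\infty))$ be the unique metric viscosity solution (in the class of continuous functions satisfying the linear growth condition given in the context) of $$\partial_t u+H(|\nabla u|)=0\ \text{ in } X\times(0,\infty),\qquad u(\cdot,0)=u_0\ \text{ in } X.$$ If $u_0$ is geodesically convex in $X$, then $u(\cdot,t)$ is geodesically convex in $X$ for all $t\ge 0$.
   Context: Geodesic spaces. A metric space $(X,d)$ is geodesic if any $x,y\in X$ are joined by a curve $\gamma:[0,1]\to X$ with $\gamma_0=x$, $\gamma_1=y$, $d(\gamma_s,\gamma_t)=|s-t|d(x,y)$. $M(x,y)$ is the set of midpoints, i.e. $M(x,y)=\{z\in X: d(x,z)=d(y,z)=d(x,y)/2\}$. A geodesic space is a Busemann space if for all $x,y,y'\in X$: $2d(z,z')\le d(y,y')$ for all $z\in M(x,y)$, $z'\in M(x,y')$. In a Busemann space $M(x,y)$ is a single point $m(x,y)$; a continuous $f:X\to\mathbb{R}$ is geodesically convex if $2f(m(x,y))\le f(x)+f(y)$ for all $x,y\in X$. Slopes. For $u$ on $X\times(0,\infty)$, $|\nabla u|(x,t)=\limsup_{y\to x}\frac{|u(y,t)-u(x,t)|}{d(x,y)}$ and $|\nabla^\pm u|(x,t)=\limsup_{y\to x}\frac{[u(y,t)-u(x,t)]_\pm}{d(x,y)}$, where $[s]_+=\max\{s,0\}$, $[s]_-=-\min\{s,0\}$. Test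 functions. $\mathcal{C}$ is the set of locally Lipschitz functions $\psi$ on $X\times(0,\infty)$ with $\partial_t\psi$ continuous; $\overline{\mathcal{C}}=\{\psi\in\mathcal{C}: |\nabla^+\psi|=|\nabla\psi|,\ |\nabla\psi| \text{ continuous}\}$; $\underline{\mathcal{C}}=\{\psi\in\mathcal{C}: |\nabla^-\psi|=|\nabla\psi|,\ |\nabla\psi| \text{ continuous}\}$. Metric viscosity solutions of $\partial_tu+H(|\nabla u|)=0$. For $a\ge0$, $p\geq 0$ put $H_a(p)=\inf\{H(p'):p'\ge 0,|p'-p|\le a\}$, $H^a(p)=\sup\{H(p'):p'\ge0,|p'-p|\le a\}$, and $|\nabla\psi|^*(x,t)=\limsup_{(x',t')\to(x,t)}|\nabla\psi|(x',t')$. An upper semicontinuous $u$ on $X\times(0,\infty)$ is a metric viscosity subsolution if whenever $\psi=\psi_1+\psi_2$ with $\psi_1\in\underline{\mathcal{C}}$, $\psi_2\in\mathcal{C}$ and $u-\psi$ has a local maximum at $(x,t)$, then $\partial_t\psi(x,t)+H_{|\nabla\psi_2|^*(x,t)}(|\nabla\psi_1|(x,t))\le0$. A lower semicontinuous $u$ is a metric viscosity supersolution if whenever $\psi=\psi_1+\psi_2$ with $\psi_1\in\overline{\mathcal{C}}$, $\psi_2\in\mathcal{C}$ and $u-\psi$ has a local minimum at $(x,t)$, then $\partial_t\psi(x,t)+H^{|\nabla\psi_2|^*(x,t)}(|\nabla\psi_1|(x,t))\ge0$. A metric viscosity solution is both. Uniqueness class: $u\in C(X\times[0,\infty))$ with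 $|u(x,t)|\le C(d(x_0,x)+t+1)$ for some $C<\infty$ and a fixed $x_0\in X$; existence and uniqueness of the solution in this class is known (Gangbo–Święch). *)

(* Defs.v *)
From HB Require Import structures.
From mathcomp Require Import all_boot all_order all_algebra.
From mathcomp Require Import all_classical all_reals all_analysis.

Set Implicit Arguments.
Unset Strict Implicit.
Unset Printing Implicit Defensive.

Import Order.TTheory GRing.Theory Num.Theory.
Import numFieldNormedType.Exports.

Local Open Scope classical_set_scope.
Local Open Scope ring_scope.

Section busemann.
Context {R : realType} (X : metricType R).
Implicit Types (x y z : X) (f : X -> R).

(* The library's [completeType] packages this property with a chosen point. *)
Definition complete_space : Prop :=
  forall F : set_system X, ProperFilter F -> cauchy F -> exists x, F --> x.

Definition geodesic_space : Prop :=
  forall x y, exists gamma : R -> X,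
    [/\ gamma 0 = x, gamma 1 = y &
        forall s t, 0 <= s <= 1 -> 0 <= t <= 1 ->
          mdist (gamma s) (gamma t) = `|s - t| * mdist x y].

Definition midpoints x y : set X :=
  [set z | mdist x z = mdist x y / 2 /\ mdist y z = mdist x y / 2].

Definition busemann_space : Prop :=
  geodesic_space /\
  forall x y y' z z', midpoints x y z -> midpoints x y' z' ->
    2 * mdist z z' <= mdist y y'.

(* The default value [x] is irrelevant in a Busemann space,
   see [midpoints_midpoint]. *)
Definition midpoint x y : X := xget x (midpoints x y).

Lemma midpoints_midpoint : busemann_space ->
  forall x y, midpoints x y = [set midpoint x y].
Proof.
move=> [geo bus] x y.
have [g [g0 g1 gE]] := geo x y.
have h1 : (0 : R) <= (2^-1 : R) <= (1 : R).
  by rewrite invr_ge0 ler0n invf_le1 ?ltr0n// ler1n.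
have Mg : midpoints x y (g 2^-1).
  split.
    rewrite -{1}g0 gE//; last by rewrite lexx ler01.
    by rewrite sub0r normrN ger0_norm ?invr_ge0// mulrC.
  rewrite -{1}g1 gE//; last by rewrite ler01 lexx.
  have {1}-> : (1 : R) = 2^-1 + 2^-1 by rewrite {1}(splitr (1 : R)) mul1r.
  by rewrite addrK ger0_norm ?invr_ge0// mulrC.
apply/seteqP; split=> [z Mz|_ ->]; last exact: (xgetPex x (ex_intro _ _ Mg)).
have Mm : midpoints x y (midpoint x y) by exact: (xgetPex x (ex_intro _ _ Mg)).
apply: mdist_positivity; apply/eqP; rewrite eq_le mdist_ge0 andbT.
by have := bus _ _ _ _ _ Mz Mm; rewrite mdistxx pmulr_rle0.
Qed.

Definition geodesically_convex f : Prop :=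
  continuous f /\ forall x y, 2 * f (midpoint x y) <= f x + f y.

Definition lipschitz_continuous f : Prop :=
  exists L : R, forall x y, `|f x - f y| <= L * mdist x y.

End busemann.

(* Functions on X x (0, oo) are encoded as functions on X * R of which only the
   values at positive times matter; since X x (0, oo) is open in X * R,
   neighbourhoods and limits at its points may be taken in X * R. *)
Section viscosity.
Context {R : realType} (X : metricType R).
Implicit Types (u psi : X * R -> R) (p q : X * R) (H : R -> R).

(* limsup of g y / d(x, y) as y -> x with y != x; it is 0 at an isolated
   point x (for nonnegative g, the only case used, [maxe] acts only there). *)
Definition limsup_ratio (g : X -> R) (x : X) : \bar R :=
  maxe 0%E (limf_esup (fun y => (g y / mdist x y)%:E) x^').

Definition slope u p : \bar R :=
  limsup_ratio (fun y => `|u (y, p.2) - u p|) p.1.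

Definition slope_plus u p : \bar R :=
  limsup_ratio (fun y => Num.max (u (y, p.2) - u p) 0) p.1.

Definition slope_minus u p : \bar R :=
  limsup_ratio (fun y => - Num.min (u (y, p.2) - u p) 0) p.1.

Definition slope_usc u p : \bar R := limf_esup (slope u) (nbhs p).

Definition dt u p : R := derive1 (fun s => u (p.1, s)) p.2.

Definition locally_lipschitz u : Prop :=
  forall p, 0 < p.2 -> exists L : R,
    \forall q & r \near p, `|u q - u r| <= L * (mdist q.1 r.1 + `|q.2 - r.2|).

Definition test_fun : set (X * R -> R) :=
  [set psi | locally_lipschitz psi /\
    forall p, 0 < p.2 ->
      derivable (fun s => psi (p.1, s)) p.2 1 /\ {for p, continuous (dt psi)}].

Definition test_fun_over : set (X * R -> R) :=
  [set psi | test_fun psi /\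
    forall p, 0 < p.2 ->
      slope_plus psi p = slope psi p /\ {for p, continuous (slope psi)}].

Definition test_fun_under : set (X * R -> R) :=
  [set psi | test_fun psi /\
    forall p, 0 < p.2 ->
      slope_minus psi p = slope psi p /\ {for p, continuous (slope psi)}].

Definition H_lower H (a p : R) : R :=
  inf [set H p' | p' in [set p' : R | 0 <= p' /\ `|p' - p| <= a]].

Definition H_upper H (a p : R) : R :=
  sup [set H p' | p' in [set p' : R | 0 <= p' /\ `|p' - p| <= a]].

(* In the next two definitions the arguments of [fine] are finite, because
   psi1 and psi2 are locally Lipschitz. *)
Definition viscosity_subsolution H u : Prop :=
  (forall p, 0 < p.2 -> forall a, u p < a -> \forall q \near p, u q < a) /\
  forall psi1 psi2, test_fun_under psi1 -> test_fun psi2 ->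
  forall p, 0 < p.2 ->
    (\forall q \near p,
       u q - (psi1 q + psi2 q) <= u p - (psi1 p + psi2 p)) ->
    dt (psi1 \+ psi2) p
      + H_lower H (fine (slope_usc psi2 p)) (fine (slope psi1 p)) <= 0.

Definition viscosity_supersolution H u : Prop :=
  (forall p, 0 < p.2 -> forall a, a < u p -> \forall q \near p, a < u q) /\
  forall psi1 psi2, test_fun_over psi1 -> test_fun psi2 ->
  forall p, 0 < p.2 ->
    (\forall q \near p,
       u p - (psi1 p + psi2 p) <= u q - (psi1 q + psi2 q)) ->
    0 <= dt (psi1 \+ psi2) p
      + H_upper H (fine (slope_usc psi2 p)) (fine (slope psi1 p)).

Definition viscosity_solution H u : Prop :=
  viscosity_subsolution H u /\ viscosity_supersolution H u.

Definition linear_growth (x0 : X) u : Prop :=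
  exists C : R, forall x t, 0 <= t -> `|u (x, t)| <= C * (mdist x0 x + t + 1).

End viscosity.

(* Main.v *)
(* A violation of convexity is excluded by doubling variables: maximize
     2 u(z,t) - u(x,s) - u(y,r) - A d(z, m(x,y))^2
       - B ((t-s)^2 + (t-r)^2) - (small increasing penalty in t, s, r).
   As a function of z, the penalty is a squared distance, whose slope
   p = A d(z, m(x,y)) (for half of it) is a descending slope, so the
   subsolution test gives H(p). By the Busemann inequality x |-> d(z, m(x,y))
   is 1/2-Lipschitz, so as a function of x (or of y) the penalty has slope at
   most p; it need not be an admissible smooth test function there, but it may
   be put entirely into psi_2 with psi_1 = 0, and since H is non-decreasing
   H^p(0) = H(p). The time derivatives of the three tests cancel, except for
   the strictly increasing penalty, which gives the contradiction.
   Maxima are not attained in X; Ekeland's principle yields them up to a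
   perturbation of small slope, which is absorbed by the continuity of H.
   The barriers |u(x,t) - u(x,0)| <= K t bound the functional from above and
   control it when one of the times vanishes. *)

Require Import Defs.
From HB Require Import structures.
From mathcomp Require Import all_boot all_order all_algebra.
From mathcomp Require Import all_classical all_reals all_analysis.
From mathcomp Require Import ring lra.

Import Order.TTheory GRing.Theory Num.Theory.
Import numFieldNormedType.Exports.

Local Open Scope classical_set_scope.
Local Open Scope ring_scope.

Set Implicit Arguments.
Unset Strict Implicit.
Unset Printing Implicit Defensive.

(** * Continuity and the perturbed maximum principle *)

Lemma continuous_within_comp (S T U : topologicalType) (A : set T)
    (f : T -> U) (r : S -> T) :
  {within A, continuous f} -> continuous r -> (forall s, A (r s)) ->
  continuous (f \o r).
Proof.
move=> /subspace_continuousP cf cr Ar s V fV.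
have AV : nbhs (r s) [set y | A y -> V (f y)] := cf _ (Ar s) V fV.
apply: (@filterS _ (nbhs s) _ _ _ _ (cr s _ AV)) => y /= Vy; exact: Vy (Ar y).
Qed.

Lemma pair_continuous (S T U : topologicalType) (f : S -> T) (g : S -> U) :
  continuous f -> continuous g -> continuous (fun x => (f x, g x)).
Proof.
by move=> cf cg x; apply: (@cvg_pair _ _ _ (nbhs x) (nbhs (f x)) (nbhs (g x)));
  [exact: cf|exact: cg].
Qed.

Lemma continuous_compose (S T U : topologicalType) (f : S -> T) (g : T -> U) :
  continuous g -> continuous f -> continuous (fun x => g (f x)).
Proof. by move=> cg cf x; apply: (cvg_comp _ _ (cf x)); exact: cg. Qed.

Lemma continuous_fst (S T U : topologicalType) (f : S -> T * U) :
  continuous f -> continuous (fun x => (f x).1).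
Proof. by move=> cf; apply: (continuous_compose _ cf) => p; exact: cvg_fst. Qed.

Lemma continuous_snd (S T U : topologicalType) (f : S -> T * U) :
  continuous f -> continuous (fun x => (f x).2).
Proof. by move=> cf; apply: (continuous_compose _ cf) => p; exact: cvg_snd. Qed.

(** The distance is kept apart from the topology so that a product can carry the sum of the
    distances of its factors; freezing all variables but one then leaves a single term of the
    perturbation. The fourth clause links the two structures, and the last is sequential
    completeness. *)
Definition complete_dist (R : realType) (Y : topologicalType)
    (D : Y -> Y -> R) : Prop :=
  [/\ forall x, D x x = 0,
      forall x y, D x y = D y x,
      forall x y z, D x z <= D x y + D y z,
      forall x (P : set Y), nbhs x P ->
        exists2 r : R, 0 < r & forall y, D y x < r -> P y &
      forall s : nat -> Y,
        (forall e, 0 < e -> exists N, forall m n, (N <= m)%N -> (N <= n)%N ->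
           D (s m) (s n) < e) ->
        exists l, forall e, 0 < e -> exists N, forall n, (N <= n)%N ->
           D (s n) l < e].

Lemma complete_dist_ge0 (R : realType) (Y : topologicalType) (D : Y -> Y -> R) :
  complete_dist D -> forall x y, 0 <= D x y.
Proof.
move=> [D0 Dsym Dtri _ _] x y.
by have := Dtri x y x; rewrite D0 (Dsym y x); lra.
Qed.

Lemma complete_dist_mdist (R : realType) (X : metricType R) :
  complete_space X -> complete_dist (@mdist R X).
Proof.
move=> cX; split.
- exact: mdistxx.
- exact: metric_sym.
- by move=> x y z; exact: metric_triangle.
- move=> x P /nbhs_ballP[r /= r0 rP]; exists r => // y yx.
  by apply: rP; rewrite ballEmdist /= metric_sym.
move=> s sC.
have : cauchy (s @ \oo).
  apply/cauchy_ballP => e e0; rewrite near_map2.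
  have [N sN] := sC e e0.
  exists ([set n | (N <= n)%N], [set n | (N <= n)%N]).
    by split; exists N.
  by move=> [m n] [/= Nm Nn]; rewrite ballEmdist /=; exact: sN.
move=> /cX[l /metricType_numDomainType.cvgrPdist_lt sl]; exists l => e e0.
have [N _ NP] := sl e e0; exists N => n Nn.
by rewrite metric_sym; exact: NP.
Qed.

Lemma complete_dist_prod (R : realType) (Y Z : topologicalType)
    (D : Y -> Y -> R) (E : Z -> Z -> R) :
  complete_dist D -> complete_dist E ->
  complete_dist (fun p q : Y * Z => D p.1 q.1 + E p.2 q.2).
Proof.
move=> cD cE; have D_ge0 := complete_dist_ge0 cD.
have E_ge0 := complete_dist_ge0 cE.
move: cD cE => [D0 Dsym Dtri Dnbhs Dcpl] [E0 Esym Etri Enbhs Ecpl]; split.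
- by move=> x; rewrite D0 E0 addr0.
- by move=> x y; rewrite Dsym Esym.
- move=> x y z; have := Dtri x.1 y.1 z.1; have := Etri x.2 y.2 z.2; lra.
- move=> [x z] P [[U V] /= [/Dnbhs[r r0 rU] /Enbhs[q q0 qV]] UVP].
  exists (Num.min r q); first by rewrite lt_min r0.
  move=> [a b] /=; rewrite lt_min => /andP[ar bq]; apply: UVP; split => /=.
    by apply: rU; have := E_ge0 b z; lra.
  by apply: qV; have := D_ge0 a x; lra.
move=> s sC.
have [e e0|l1 sl1] := Dcpl (fun n => (s n).1).
  have [N NP] := sC e e0; exists N => m n Nm Nn.
  by have := NP m n Nm Nn; have := E_ge0 (s m).2 (s n).2; lra.
have [e e0|l2 sl2] := Ecpl (fun n => (s n).2).
  have [N NP] := sC e e0; exists N => m n Nm Nn.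
  by have := NP m n Nm Nn; have := D_ge0 (s m).1 (s n).1; lra.
exists (l1, l2) => e e0; have e20 : 0 < e / 2 by lra.
have [N1 N1P] := sl1 _ e20; have [N2 N2P] := sl2 _ e20.
exists (maxn N1 N2) => n; rewrite geq_max => /andP[N1n N2n] /=.
by have := N1P n N1n; have := N2P n N2n; lra.
Qed.

(** Ekeland's variational principle for upper semicontinuous functions bounded above. The relation
    [S] is transitive, so an iteration that climbs along it is Cauchy, and its limit leaves no room
    for further gain. *)
Lemma ekeland (R : realType) (Y : topologicalType) (D : Y -> Y -> R)
    (F : Y -> R) (M delta : R) (y0 : Y) :
  complete_dist D ->
  (forall y, F y <= M) ->
  (forall y c, F y < c -> \forall z \near y, F z < c) ->
  0 < delta ->
  exists y, F y0 <= F y /\ forall z, F z <= F y + delta * D z y.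
Proof.
move=> cD FM Fusc d0; have D_ge0 := complete_dist_ge0 cD.
have [D0 Dsym Dtri Dnbhs Dcpl] := cD.
pose S y := [set w | F y + delta * D w y <= F w].
have Sxx y : S y y by rewrite /S /= D0 mulr0 addr0.
(* From y, move to a point of [S y] making at least half of the possible
   progress; the progress then tends to zero along the iteration. *)
have stepP y : exists y', S y y' /\ forall w, S y w -> F w - F y' <= F y' - F y.
  apply: contrapT => /forallNP noy.
  pose s := sup (F @` S y).
  have Ss w : S y w -> F w <= s.
    move=> Sw; apply: ub_le_sup; last by exists w.
    by exists M => _ [z _ <-].
  (* A point of [S y] above the middle of [F y] and [s] would be an admissible choice. Hence
     [s <= F y], and then [y] itself is admissible. *)
  have sle : s <= (F y + s) / 2.
    apply: ge_sup; first by exists (F y), y.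
    move=> _ [w Sw <-]; rewrite leNgt; apply/negP => wlt.
    apply: (noy w); split => // v /Ss; lra.
  apply: (noy y); split; first exact: Sxx.
  move=> w /Ss; lra.
have [step stepS] := choice stepP.
pose s n := iter n step y0.
have Fmono m n : (m <= n)%N -> F (s m) + delta * D (s n) (s m) <= F (s n).
  elim: n => [|n IHn]; first by rewrite leqn0 => /eqP ->; exact: Sxx.
  rewrite leq_eqVlt => /orP[/eqP ->|]; first exact: Sxx.
  rewrite ltnS => /IHn h; have [+ _] := stepS (s n); rewrite /S /= -/(s n.+1).
  have := Dtri (s n.+1) (s n) (s m); rewrite -(ler_pM2l d0) mulrDr; lra.
have Fcauchy e : 0 < e -> exists N, forall m, (N <= m)%N ->
    F (s m) - F (s N) < e.
  move=> e0; have sF : has_sup (range (F \o s)).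
    by split; [exists (F (s 0)), 0%N|exists M => _ [n _ <-] /=].
  have [_ [N _ <-] /= hN] := sup_adherent e0 sF.
  exists N => m _; have := ub_le_sup sF.2 (imageT (F \o s) m) => /=; lra.
have [e e0|l sl] := Dcpl s.
  have de0 : 0 < delta * e / 2 by rewrite !mulr_gt0// invr_gt0.
  have [N NP] := Fcauchy _ de0; exists N => m n Nm Nn.
  have := Dtri (s m) (s N) (s n); rewrite (Dsym (s N)) -(ltr_pM2l d0).
  rewrite -(ler_pM2l d0) mulrDr.
  have := NP _ Nm; have := NP _ Nn; have := Fmono _ _ Nm; have := Fmono _ _ Nn.
  lra.
(* Upper semicontinuity carries the relation to the limit: far along the sequence, [F] is at most
   [F l + e / 2]. *)
have Sl n : S (s n) l.
  rewrite /S /=; apply/ler_addgt0Pl => e e0.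
  have e20 : 0 < e / 2 by lra.
  have [r r0 rP] := Dnbhs _ _ (Fusc l (F l + e / 2) ltac:(lra)).
  have rm0 : 0 < Num.min r (e / 2 / delta) by rewrite lt_min r0 divr_gt0.
  have [N NP] := sl _ rm0.
  have := NP (maxn N n) (leq_maxl _ _); rewrite lt_min => /andP[/rP h1].
  rewrite ltr_pdivlMr// => h2.
  have := Fmono _ _ (leq_maxr N n); have := Dtri l (s (maxn N n)) (s n).
  rewrite (Dsym l (s (maxn N n))) -(ler_pM2l d0) mulrDr; lra.
exists l; split.
  have := Sl 0%N; rewrite /S /= /s /=.
  have := mulr_ge0 (ltW d0) (D_ge0 l y0); lra.
(* A point [w] above the cone at [l] lies in every [S (s N)]. Once the progress is smaller than
   [F w - F l], the choice of the next iterate forces its value above [F l], contrary to [Sl]. *)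
move=> w; rewrite leNgt; apply/negP => wl.
have lw : F l < F w by have := mulr_ge0 (ltW d0) (D_ge0 w l); lra.
have [N NP] := Fcauchy (F w - F l) ltac:(lra).
have [_ /(_ w)] := stepS (s N); rewrite /S /= -/(s N.+1).
have := NP _ (leqnSn N); have := Sl N; have := Sl N.+1; rewrite /S /=.
have := Dtri w l (s N); rewrite -(ler_pM2l d0) mulrDr.
have := mulr_ge0 (ltW d0) (D_ge0 l (s N.+1)).
move=> h1 h2 h3 h4 h5 /(_ ltac:(lra)); lra.
Qed.

(* Taking the maximum over the compact parameter set first confines the
   nonsmooth perturbation to the Y variable. *)
Lemma perturbed_max (R : realType) (Y T : topologicalType) (D : Y -> Y -> R)
    (K : set T) (Phi : Y * T -> R) (M delta : R) (y0 : Y) (t0 : T) :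
  complete_dist D -> compact K -> K t0 -> continuous Phi ->
  (forall y t, K t -> Phi (y, t) <= M) -> 0 < delta ->
  exists y t, [/\ K t, Phi (y0, t0) <= Phi (y, t) &
    forall z s, K s -> Phi (z, s) <= Phi (y, t) + delta * D z y].
Proof.
move=> cD cK Kt0 cPhi PhiM d0.
have maxP y : exists t, K t /\ forall s, K s -> Phi (y, s) <= Phi (y, t).
  have [||t tK tP] := @compact_EVT_max T R (fun t => Phi (y, t)) K _ cK.
  - by exists t0.
  - apply: continuous_subspaceT => t.
    apply: continuous_comp; last exact: cPhi.
    by apply: cvg_pair; [exact: cvg_cst|exact: cvg_id].
  exists t; split; first exact: set_mem.
  by move=> s /mem_set; exact: tP.
have [tau tauP] := choice maxP.
have [|y c /= yc||y [y0y yP]] :=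
  @ekeland R Y D (fun y => Phi (y, tau y)) M delta y0 cD.
- by move=> y; apply: PhiM; case: (tauP y).
(* The maximum over [K] is upper semicontinuous in [y]: by compactness, a strict bound on the fibre
   over [y] persists on all nearby fibres. *)
- have near_c : \forall z \near y, K `<=` [set t | Phi (z, t) < c].
    apply: (iffLR (compact_near_coveringP K) cK) => t Kt.
    have ytc : Phi (y, t) < c by apply: le_lt_trans yc; exact: (tauP y).2.
    have /= [[U V] /= [Uy Vt] UV] := cPhi (y, t) _ (lt_nbhsl ytc).
    by exists (V, U) => // -[s z] [/= Vs Uz]; exact: (UV (z, s)).
  by move: near_c; apply: filterS => z; apply; case: (tauP z).
- by [].
exists y, (tau y); have [Kty max_y] := tauP y; split => //.
  by apply: le_trans y0y; exact: (tauP y0).2.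
move=> z s Ks; apply: le_trans (yP z); exact: (tauP z).2.
Qed.

(** * Slopes and separated test functions *)

Lemma nbhs_mdist_lt (R : realType) (X : metricType R) (x : X) (r : R) :
  0 < r -> \forall y \near x, mdist y x < r.
Proof.
move=> r0; apply: filterS (nbhsx_ballx x r r0) => y.
by rewrite ballEmdist /= metric_sym.
Qed.

Lemma cvg_mdist (R : realType) (X : metricType R) (T : Type)
    (F : set_system T) (FF : Filter F) (f g : T -> X) (a b : X) :
  f @ F --> a -> g @ F --> b ->
  (fun t => mdist (f t) (g t)) @ F --> mdist a b.
Proof.
move=> fa gb; apply/cvgrPdist_lt => e e0; have e20 : 0 < e / 2 by lra.
have fa' : \forall t \near F, mdist (f t) a < e / 2.
  exact: (fa _ (nbhs_mdist_lt a e20)).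
have gb' : \forall t \near F, mdist (g t) b < e / 2.
  exact: (gb _ (nbhs_mdist_lt b e20)).
near=> t.
have fta : mdist (f t) a < e / 2 by near: t.
have gtb : mdist (g t) b < e / 2 by near: t.
have := metric_triangle a (f t) b; have := metric_triangle (f t) (g t) b.
have := metric_triangle (f t) a (g t); have := metric_triangle a b (g t).
rewrite (metric_sym a (f t)) (metric_sym b (g t)) ltr_norml; lra.
Unshelve. all: by end_near. Qed.

Section slopes.
Context {R : realType} (X : metricType R).
Implicit Types (x y z : X) (g : X -> R) (c : R).

Lemma limsup_ratio_ge0 g x : (0 <= limsup_ratio g x)%E.
Proof. by rewrite /limsup_ratio le_max lexx. Qed.

Lemma limsup_ratio_le g x c : 0 <= c ->
  (forall e, 0 < e -> exists2 r, 0 < r &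
     forall y, mdist y x < r -> g y <= (c + e) * mdist y x) ->
  (limsup_ratio g x <= c%:E)%E.
Proof.
move=> c0 gc; rewrite /limsup_ratio ge_max lee_fin c0 /=.
apply/lee_addgt0Pr => e e0; have [r r0 rP] := gc e e0.
apply: (@le_trans _ _ (ereal_sup ((fun y => (g y / mdist x y)%:E) @`
   [set y | mdist y x < r /\ y != x]))).
  apply: ereal_inf_lbound => /=; exists [set y | mdist y x < r /\ y != x] => //.
  apply: filterS (nbhs_mdist_lt x r0) => y yr yx; split => //.
apply: ge_ereal_sup => _ [y [yr yx] <-]; rewrite -EFinD lee_fin.
by rewrite ler_pdivrMr ?mdist_gt0 1?eq_sym// (metric_sym x); exact: rP.
Qed.

Lemma limsup_ratio_ge g x c :
  (forall e, 0 < e -> forall r, 0 < r -> exists y,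
     [/\ y != x, mdist y x < r & (c - e) * mdist y x <= g y]) ->
  (c%:E <= limsup_ratio g x)%E.
Proof.
move=> gc; rewrite /limsup_ratio le_max; apply/orP; right.
apply: le_ereal_inf_tmp => _ [U Ux <-].
have /nbhs_ballP[r /= r0 rU] : nbhs x [set y | y != x -> U y] by exact: Ux.
apply/lee_addgt0Pr => e e0; have [y [yx yr cy]] := gc e e0 r r0.
rewrite -leeBlDr// -EFinB; apply: (@le_trans _ _ (g y / mdist x y)%:E).
  by rewrite lee_fin ler_pdivlMr ?mdist_gt0 1?eq_sym// (metric_sym x).
apply: ereal_sup_ubound; exists y => //; apply: rU => //.
by rewrite ballEmdist /= metric_sym.
Qed.

Lemma limsup_ratio_mono (f g : X -> R) x : (forall y, f y <= g y) ->
  (limsup_ratio f x <= limsup_ratio g x)%E.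
Proof.
move=> fg; rewrite /limsup_ratio ge_max le_max lexx /= le_max.
apply/orP; right; apply: le_ereal_inf_tmp => _ [U Ux <-].
apply: (@le_trans _ _ (ereal_sup ((fun y => (f y / mdist x y)%:E) @` U))).
  by apply: ereal_inf_lbound; exists U.
apply: ge_ereal_sup => _ [y Uy <-].
apply: (@le_trans _ _ (g y / mdist x y)%:E).
  by rewrite lee_fin ler_wpM2r// invr_ge0 mdist_ge0.
by apply: ereal_sup_ubound; exists y.
Qed.

(** An upper bound for the asymptotic Lipschitz constant at [x]. Both points are free, so that
    slopes at points near [x] are controlled too, as [slope_usc] demands. *)
Definition lip_at g x c : Prop :=
  forall e, 0 < e -> exists2 r, 0 < r & forall y z,
    mdist y x < r -> mdist z x < r -> `|g y - g z| <= (c + e) * mdist y z.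

Lemma lip_atD g1 g2 x c1 c2 :
  lip_at g1 x c1 -> lip_at g2 x c2 -> lip_at (g1 \+ g2) x (c1 + c2).
Proof.
move=> g1c g2c e e0; have e20 : 0 < e / 2 by lra.
have [r1 r10 r1P] := g1c _ e20; have [r2 r20 r2P] := g2c _ e20.
exists (Num.min r1 r2); first by rewrite lt_min r10.
move=> y z; rewrite !lt_min => /andP[yr1 yr2] /andP[zr1 zr2] /=.
have := ler_normD (g1 y - g1 z) (g2 y - g2 z).
rewrite (_ : _ + (_ - _) = g1 y + g2 y - (g1 z + g2 z)); last by ring.
have := r1P _ _ yr1 zr1; have := r2P _ _ yr2 zr2; lra.
Qed.

Lemma lip_atN g x c : lip_at g x c -> lip_at (\- g) x c.
Proof.
move=> gc e /gc[r r0 rP]; exists r => // y z yr zr /=.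
by rewrite -opprD normrN; exact: rP.
Qed.

Lemma lip_at_lipschitz g c :
  (forall y z, `|g y - g z| <= c * mdist y z) -> forall x, lip_at g x c.
Proof.
move=> gc x e e0; exists 1 => // y z _ _; apply: (le_trans (gc y z)).
by rewrite ler_wpM2r ?mdist_ge0//; lra.
Qed.

Lemma lip_at_dist c z x : 0 <= c -> lip_at (fun y => c * mdist y z) x c.
Proof.
move=> c0; apply: lip_at_lipschitz => y w.
rewrite -mulrBr normrM (ger0_norm c0) ler_wpM2l// ler_norml.
have := metric_triangle y w z; have := metric_triangle w y z.
by rewrite (metric_sym w y) => *; apply/andP; split; lra.
Qed.

(** Factor the difference of squares: [f y + f z] tends to [2 * f x], and [f y - f z] is at most
    [l * mdist y z]. The radius keeps [A * l * f] within [e / 2] of its value at [x]. *)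
Lemma lip_at_sqr (f : X -> R) A l x : 0 <= A -> 0 <= l ->
  (forall y, 0 <= f y) ->
  (forall y z, `|f y - f z| <= l * mdist y z) ->
  lip_at (fun y => A * f y ^+ 2) x (2 * A * l * f x).
Proof.
move=> A0 l0 f0 fl e e0.
have Al0 : 0 < 2 * A * l * l + 1 by rewrite ltr_wpDl// !mulr_ge0.
exists (e / (2 * A * l * l + 1)); first by rewrite divr_gt0.
have fle y : mdist y x < e / (2 * A * l * l + 1) ->
    A * l * f y <= A * l * f x + e / 2.
  rewrite ltr_pdivlMr// => yr; have := fl y x; rewrite ler_norml => /andP[_].
  have Al : 0 <= A * l by exact: mulr_ge0.
  have := mdist_ge0 y x; move=> dyx /(ler_wpM2l Al).
  nra.
move=> y z /fle yle /fle zle.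
rewrite -mulrBr subr_sqr mulrA (normrM _ (f y + f z)).
rewrite (ger0_norm (addr_ge0 (f0 y) (f0 z))) normrM (ger0_norm A0).
apply: (@le_trans _ _ (A * (l * mdist y z) * (f y + f z))).
  by rewrite ler_wpM2r ?addr_ge0// ler_wpM2l.
rewrite (_ : _ * (f y + f z) = (A * l * f y + A * l * f z) * mdist y z).
  by rewrite ler_wpM2r ?mdist_ge0//; lra.
by ring.
Qed.

End slopes.

Section spacetime.
Context {R : realType} (X : metricType R).
Implicit Types (x y z : X) (g : X -> R) (a b c t : R).

(** In this separated form the slope sees only [g] and the time derivative only the quadratic, so
    the two are computed independently. *)
Definition spacetime g a b : X * R -> R :=
  fun q => g q.1 + (a * q.2 ^+ 2 + b * q.2).

Lemma spacetimeB g a b x y t :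
  spacetime g a b (y, t) - spacetime g a b (x, t) = g y - g x.
Proof. by rewrite /spacetime /=; ring. Qed.

Lemma slope_spacetime_le g a b x t c : 0 <= c -> lip_at g x c ->
  (slope (spacetime g a b) (x, t) <= c%:E)%E.
Proof.
move=> c0 gc; apply: limsup_ratio_le => // e /gc[r r0 rP]; exists r => // y yr.
rewrite spacetimeB; apply: rP => //.
by rewrite mdistxx.
Qed.

(** Around any point of the [r]-ball at [x] a smaller ball still lies inside, so the bound [c + e]
    holds for all nearby slopes. Both bounds together make the value finite, hence [fine]
    faithful. *)
Lemma slope_usc_spacetime g a b x t c : 0 <= c -> lip_at g x c ->
  (0 <= slope_usc (spacetime g a b) (x, t) <= c%:E)%E.
Proof.
move=> c0 gc; apply/andP; split.
  apply: limf_esup_ge0; first exact: filter_not_empty.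
  by move=> q; exact: limsup_ratio_ge0.
apply/lee_addgt0Pr => e e0; have [r r0 rP] := gc e e0.
apply: (@le_trans _ _ (ereal_sup (slope (spacetime g a b) @`
   [set q | mdist q.1 x < r]))).
  apply: ereal_inf_lbound => /=; exists [set q : X * R | mdist q.1 x < r] => //.
  exists ([set y | mdist y x < r], setT).
    by split => /=; [exact: nbhs_mdist_lt|exact: filterT].
  by move=> q [].
apply: ge_ereal_sup => _ [[y s] /= yr <-]; rewrite -EFinD.
apply: slope_spacetime_le; first by lra.
move=> d d0; exists (r - mdist y x); first by lra.
move=> z w zr wr.
have := metric_triangle z y x; have := metric_triangle w y x => h1 h2.
apply: le_trans (rP z w _ _) _; [lra|lra|].
by rewrite ler_wpM2r ?mdist_ge0//; lra.
Qed.

Lemma is_derive_quadratic a b c t :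
  is_derive t 1 (fun s : R => c + (a * s ^+ 2 + b * s)) (2 * a * t + b).
Proof.
apply: is_derive_eq.
by rewrite /GRing.scale /=; ring.
Qed.

Lemma dt_spacetime g a b p : dt (spacetime g a b) p = 2 * a * p.2 + b.
Proof.
rewrite /dt derive1E; have := is_derive_quadratic a b (g p.1) p.2.
by move=> dv; exact: derive_val.
Qed.

Lemma test_fun_spacetime g a b :
  (forall x, exists c, lip_at g x c) -> test_fun (spacetime g a b).
Proof.
move=> gl; split.
  move=> [x t] /= _; have [c gc] := gl x.
  have [r r0 rP] := gc 1 ltr01.
  (* The first term is the Lipschitz bound of [g] for [e = 1]; in the second, [2 * |t| + 2] bounds
     the sum of two times within distance 1 of [t]. *)
  pose L := `|c + 1| + (`|a| * (2 * `|t| + 2) + `|b|).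
  exists L.
  have nb : nbhs (x, t) [set q : X * R | mdist q.1 x < r /\ `|q.2 - t| < 1].
    exists ([set y | mdist y x < r], [set s | `|s - t| < 1]).
      split => /=; first exact: nbhs_mdist_lt.
      by apply/nbhs_ballP; exists 1 => //= s; rewrite /ball /= distrC.
    by move=> q [].
  exists ([set q | mdist q.1 x < r /\ `|q.2 - t| < 1],
          [set q | mdist q.1 x < r /\ `|q.2 - t| < 1]); first by split.
  move=> [[y s] [z v]] [/= [yr sr] [zr vr]]; rewrite /spacetime /=.
  rewrite (_ : _ - _ = (g y - g z) + (a * (s + v) + b) * (s - v)); last by ring.
  have h1 : `|g y - g z| <= `|c + 1| * mdist y z.
    by apply: le_trans (rP _ _ yr zr) _; rewrite ler_wpM2r ?mdist_ge0// ler_norm.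
  have h2 : `|a * (s + v) + b| <= `|a| * (2 * `|t| + 2) + `|b|.
    apply: le_trans (ler_normD _ _) _; rewrite lerD2r normrM ler_wpM2l//.
    have := ler_normD (s - t + (v - t)) (t + t).
    rewrite (_ : _ + (t + t) = s + v); last by ring.
    have := ler_normD (s - t) (v - t); have := ler_normD t t; lra.
  apply: le_trans (ler_normD _ _) _; rewrite normrM.
  have := ler_wpM2r (normr_ge0 (s - v)) h2.
  have := mulr_ge0 (normr_ge0 (c + 1)) (normr_ge0 (s - v)).
  have : 0 <= (`|a| * (2 * `|t| + 2) + `|b|) * mdist y z.
    by rewrite mulr_ge0 ?mdist_ge0// addr_ge0// mulr_ge0// addr_ge0// mulr_ge0.
  by rewrite /L mulrDr !mulrDl; lra.
move=> p _; split; first by case: (is_derive_quadratic a b (g p.1) p.2).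
rewrite (_ : dt _ = fun p => 2 * a * p.2 + b); last first.
  by apply/funext => q; rewrite dt_spacetime.
by apply: cvgD; [apply: cvgMr; exact: cvg_snd|exact: cvg_cst].
Qed.

(* Moving along a geodesic towards [m] realises the slope of the squared
   distance to [m] as a descending slope. *)
Lemma slopes_sqr_dist (geo : geodesic_space X) m A a b p : 0 <= A ->
  let psi := spacetime (fun y => A * mdist y m ^+ 2) a b in
  slope psi p = (2 * A * mdist p.1 m)%:E /\
  slope_minus psi p = (2 * A * mdist p.1 m)%:E.
Proof.
case: p => x t A0 psi /=.
have lipA : lip_at (fun y => A * mdist y m ^+ 2) x (2 * A * mdist x m).
  have := @lip_at_sqr R X (fun y => mdist y m) A 1 x A0 ler01.
  rewrite mulr1; apply => [y|y z]; first exact: mdist_ge0.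
  rewrite mul1r ler_norml.
  have := metric_triangle y z m; have := metric_triangle z y m.
  by rewrite (metric_sym z y) => *; apply/andP; split; lra.
have p0 : 0 <= 2 * A * mdist x m by rewrite !mulr_ge0 ?mdist_ge0.
have min_le (v : R) : - Num.min v 0 <= `|v|.
  by have := ler_norm (- v); rewrite normrN minEle; case: ifP; have := normr_ge0 v; lra.
have min_ge (v : R) : - v <= - Num.min v 0.
  by rewrite minEle; case: ifPn => //; rewrite -ltNge; lra.
have lower : ((2 * A * mdist x m)%:E <= slope_minus psi (x, t))%E.
  have [->|xm] := eqVneq x m; first by rewrite mdistxx mulr0 limsup_ratio_ge0.
  have D0 : 0 < mdist x m by rewrite mdist_gt0.
  have [gamma [g0 g1 gE]] := geo x m.
  apply: limsup_ratio_ge => e e0 r r0.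
  (* The three bounds keep [s] on the geodesic, keep [gamma s] inside the [r]-ball, and make the
     quadratic error [s * (A * mdist x m)] at most [e]. *)
  pose s := Num.min 1 (Num.min (r / (2 * mdist x m)) (e / (A * mdist x m + 1))).
  have AD0 : 0 < A * mdist x m + 1 by rewrite ltr_wpDl// mulr_ge0// ltW.
  have s0 : 0 < s.
    by rewrite /s !lt_min ltr01 /= !divr_gt0// mulr_gt0.
  have [s1 sr se] : [/\ s <= 1, s * (2 * mdist x m) <= r &
      s * (A * mdist x m + 1) <= e].
    split; first by rewrite /s ge_min lexx.
      by rewrite -ler_pdivlMr ?mulr_gt0// /s !ge_min lexx orbT.
    by rewrite -ler_pdivlMr// /s !ge_min lexx !orbT.
  have dx : mdist (gamma s) x = s * mdist x m.
    rewrite -{1}g0 gE ?lexx ?ler01 ?(ltW s0)// subr0 ger0_norm//; exact: ltW.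
  have dm : mdist (gamma s) m = (1 - s) * mdist x m.
    rewrite -{1}g1 gE ?lexx ?ler01 ?(ltW s0)// distrC ger0_norm//; lra.
  exists (gamma s); split.
  - by rewrite -mdist_gt0 dx mulr_gt0.
  - rewrite dx; have := mulr_gt0 s0 D0; lra.
  apply: le_trans (min_ge _); rewrite /psi /spacetime /= dm dx.
  have -> : - (A * ((1 - s) * mdist x m) ^+ 2 + (a * t ^+ 2 + b * t) -
     (A * mdist x m ^+ 2 + (a * t ^+ 2 + b * t))) =
     (2 * A * mdist x m - s * (A * mdist x m)) * (s * mdist x m) by ring.
  by rewrite ler_wpM2r ?mulr_ge0// ?ltW//; lra.
split; apply/eqP; rewrite eq_le; apply/andP; split => //.
- exact: slope_spacetime_le.
- apply: le_trans lower _; apply: limsup_ratio_mono => y; exact: min_le.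
- apply: limsup_ratio_le => // e /lipA[r r0 rP]; exists r => // y yr.
  apply: le_trans (min_le _) _; rewrite /psi spacetimeB.
  by apply: rP => //; rewrite mdistxx.
Qed.

End spacetime.

(** * Viscosity inequalities at global extrema *)

Section test_inequalities.
Context {R : realType} (X : metricType R) (H : R -> R) (u : X * R -> R).

Lemma H_lower_ge a c p :
  (forall p q : R, 0 <= p -> p <= q -> H p <= H q) ->
  0 <= a <= c -> 0 <= p ->
  H (Num.max (p - c) 0) <= H_lower H a p.
Proof.
move=> H_mono /andP[a0 ac] p0; apply: lb_le_inf.
  by exists (H p), p => //=; rewrite subrr normr0.
move=> _ [q /= [q0 qp] <-]; apply: H_mono; first by rewrite le_max lexx orbT.
move: qp; rewrite ge_max q0 andbT ler_norml => /andP[]; lra.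
Qed.

Lemma H_upper0_le a c :
  (forall p q : R, 0 <= p -> p <= q -> H p <= H q) ->
  0 <= a <= c -> H_upper H a 0 <= H c.
Proof.
move=> H_mono /andP[a0 ac]; apply: ge_sup.
  by exists (H 0), 0 => //=; rewrite subrr normr0.
move=> _ [q /= [q0 qp] <-]; apply: H_mono => //.
by move: qp; rewrite subr0 ger0_norm//; lra.
Qed.

Lemma near_of_strip (P : set (X * R)) (z : X) (t T : R) : 0 < t < T ->
  (forall y s, 0 <= s <= T -> P (y, s)) -> nbhs (z, t) P.
Proof.
move=> /andP[t0 tT] PT; exists (setT, [set s | 0 < s] `&` [set s | s < T]).
  split => /=; first exact: filterT.
  by apply: filterI; [exact: lt_nbhsr|exact: lt_nbhsl].
by move=> [y s] [_ /= [s0 sT]]; apply: PT; rewrite !ltW.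
Qed.

(** The squared distance goes into [psi1], where its descending slope is admissible; [g] goes into
    [psi2] and costs at most [c] in the argument of [H]. *)
Lemma subsolution_at_max A m (g : X -> R) a b z t c T :
  (forall p q : R, 0 <= p -> p <= q -> H p <= H q) ->
  geodesic_space X -> viscosity_subsolution H u ->
  0 <= A -> 0 <= c -> (forall x, exists c', lip_at g x c') -> lip_at g z c ->
  0 < t < T ->
  (forall y s, 0 <= s <= T ->
    u (y, s) - (A * mdist y m ^+ 2 + g y + (a * s ^+ 2 + b * s)) <=
    u (z, t) - (A * mdist z m ^+ 2 + g z + (a * t ^+ 2 + b * t))) ->
  2 * a * t + b + H (Num.max (2 * A * mdist z m - c) 0) <= 0.
Proof.
move=> H_mono geo [_ sub] A0 c0 gl gc tT zmax; have [t0 _] := andP tT.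
pose psi1 := spacetime (fun y => A * mdist y m ^+ 2) 0 0.
have slope1 := slopes_sqr_dist geo m 0 0 _ A0.
have under1 : test_fun_under psi1.
  split.
    apply: test_fun_spacetime => x; exists (2 * A * 1 * mdist x m).
    apply: (@lip_at_sqr R X (fun y => mdist y m)) => // y; first exact: mdist_ge0.
    move=> w; rewrite mul1r ler_norml.
    have := metric_triangle y w m; have := metric_triangle w y m.
    by rewrite (metric_sym w y) => *; apply/andP; split; lra.
  move=> p _; have [s1 s2] := slope1 p; split; first by rewrite /psi1 s1 s2.
  rewrite (_ : slope psi1 = fun p => (2 * A * mdist p.1 m)%:E); last first.
    by apply/funext => q; have [] := slope1 q.
  apply: cvg_EFin; first by near=> q.
  apply: cvgMr; apply: cvg_mdist; [exact: cvg_fst|exact: cvg_cst].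
have := sub psi1 (spacetime g a b) under1 (test_fun_spacetime a b gl) (z, t) t0.
have -> : dt (psi1 \+ spacetime g a b) (z, t) = 2 * a * t + b.
  rewrite (_ : _ \+ _ = spacetime (fun y => A * mdist y m ^+ 2 + g y) a b).
    by rewrite dt_spacetime.
  by apply/funext => q; rewrite /psi1 /spacetime /=; ring.
rewrite /psi1 (slope1 (z, t)).1 [fine (2 * A * _)%:E]/=.
have /andP[] := slope_usc_spacetime a b t c0 gc.
case: (slope_usc _ _) => [d| |] //; rewrite !lee_fin => d0 dc /= main.
have /main {main} : \forall q \near (z, t), u q -
      (spacetime (fun y => A * mdist y m ^+ 2) 0 0 q + spacetime g a b q) <=
    u (z, t) - (spacetime (fun y => A * mdist y m ^+ 2) 0 0 (z, t) +
      spacetime g a b (z, t)).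
  apply: (near_of_strip z tT) => y s sT; have := zmax y s sT.
  by rewrite /spacetime /=; lra.
have := @H_lower_ge d c (2 * A * mdist z m) H_mono.
rewrite d0 dc !mulr_ge0 ?mdist_ge0// => /(_ isT isT); lra.
Unshelve. all: by end_near. Qed.

(** With [psi1 = 0] the whole spatial part goes into [psi2], so a Lipschitz bound on it suffices,
    and monotonicity bounds the supremum of [H] by [H c]. *)
Lemma supersolution_at_min (g : X -> R) a b z t c T :
  (forall p q : R, 0 <= p -> p <= q -> H p <= H q) ->
  viscosity_supersolution H u ->
  0 <= c -> (forall x, exists c', lip_at g x c') -> lip_at g z c ->
  0 < t < T ->
  (forall y s, 0 <= s <= T ->
    u (z, t) - (g z + (a * t ^+ 2 + b * t)) <=
    u (y, s) - (g y + (a * s ^+ 2 + b * s))) ->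
  0 <= 2 * a * t + b + H c.
Proof.
move=> H_mono [_ super] c0 gl gc tT zmin; have [t0 _] := andP tT.
pose psi1 := spacetime (fun _ : X => 0 : R) 0 0.
have cst_lip x : lip_at (fun _ : X => 0 : R) x 0.
  apply: lip_at_lipschitz => y w; rewrite subrr normr0 mul0r //.
have psi1_slope p : slope psi1 p = 0%E.
  apply/eqP; rewrite eq_le andbC {1}/slope limsup_ratio_ge0 /=.
  by case: p => x s; exact: slope_spacetime_le.
have over1 : test_fun_over psi1.
  split; first by apply: test_fun_spacetime => x; exists 0.
  move=> p _; split.
    rewrite psi1_slope; apply/eqP; rewrite eq_le limsup_ratio_ge0 andbT.
    rewrite -(psi1_slope p); apply: limsup_ratio_mono.
    move=> y; rewrite maxEle; case: ifP => // _; exact: ler_norm.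
  rewrite (_ : slope psi1 = fun=> 0%E); first exact: cvg_cst.
  by apply/funext => q; rewrite psi1_slope.
have := super psi1 (spacetime g a b) over1 (test_fun_spacetime a b gl) (z, t) t0.
have -> : dt (psi1 \+ spacetime g a b) (z, t) = 2 * a * t + b.
  rewrite (_ : _ \+ _ = spacetime g a b).
    by rewrite dt_spacetime.
  by apply/funext => q; rewrite /psi1 /spacetime /=; ring.
rewrite psi1_slope [fine 0%E]/=.
have /andP[] := slope_usc_spacetime a b t c0 gc.
case: (slope_usc _ _) => [d| |] //; rewrite !lee_fin => d0 dc /= main.
have /main {main} : \forall q \near (z, t),
    u (z, t) - (psi1 (z, t) + spacetime g a b (z, t)) <=
    u q - (psi1 q + spacetime g a b q).
  apply: (near_of_strip z tT) => y s sT; have := zmin y s sT.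
  by rewrite /psi1 /spacetime /=; lra.
have := @H_upper0_le d c H_mono; rewrite d0 dc => /(_ isT); lra.
Qed.

End test_inequalities.

(** The increment vanishes at [d = 0], and compactness of the range of slopes makes its smallness
    uniform. Thus the Ekeland parameter can be fixed once [P] and [sg] are known. *)
Lemma uniform_increment (R : realType) (H : R -> R) (P sg : R) :
  {within [set p : R | 0 <= p], continuous H} -> 0 < sg ->
  exists2 d, 0 < d & forall p, 0 <= p <= P ->
    H (p + d) - H (Num.max (p - d) 0) < sg.
Proof.
move=> cH sg0.
(* Extending [H] by its value at 0 gives a function continuous on the whole line. *)
pose K p := H (Num.max p 0).
have cK : continuous K.
  apply: (@continuous_within_comp R R R _ H (fun q => Num.max q 0) cH).
    by apply: max_fun_continuous => q; [exact: cvg_id|exact: cvg_cst].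
  by move=> q /=; rewrite le_max lexx orbT.
have cKd : continuous (fun q : R * R => K (q.1 + q.2) - K (q.1 - q.2)).
  have cadd : continuous (fun q : R * R => q.1 + q.2).
    by move=> q; apply: cvgD; [exact: cvg_fst|exact: cvg_snd].
  have csub : continuous (fun q : R * R => q.1 - q.2).
    by move=> q; apply: cvgB; [exact: cvg_fst|exact: cvg_snd].
  move=> q; apply: cvgB.
    by apply: (continuous_comp (cadd q)); exact: cK.
  by apply: (continuous_comp (csub q)); exact: cK.
have : \forall d \near (0 : R),
    `[0, P]%classic `<=` [set p | K (p + d) - K (p - d) < sg].
  have /compact_near_coveringP cov := @segment_compact R 0 P.
  apply: (cov R (nbhs (0 : R)) (fun d p => K (p + d) - K (p - d) < sg)) => p _.
  have psg : K (p + 0) - K (p - 0) < sg by rewrite addr0 subr0 subrr.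
  have /= [[U V] /= [Up V0] UV] := cKd (p, 0) _ (lt_nbhsl psg).
  by exists (U, V) => // -[q d] [/= Uq Vd]; exact: (UV (q, d)).
move=> /nbhs_ballP[r /= r0 rP]; exists (r / 2); first by rewrite divr_gt0.
move=> p /andP[p0 pP].
have /rP/(_ p) : ball 0 r (r / 2).
  by rewrite /ball /= sub0r normrN gtr0_norm ?divr_gt0//; lra.
rewrite /= in_itv /= p0 pP => /(_ isT); rewrite /K (max_l (x := p + _))//.
by lra.
Qed.

(** * Midpoints and initial barriers *)

Section midpoints.
Context {R : realType} (X : metricType R).
Implicit Types (x y z : X).

Lemma midpointP (bus : busemann_space X) x y :
  midpoints x y (midpoint x y).
Proof. by rewrite (midpoints_midpoint bus). Qed.

Lemma midpointC (bus : busemann_space X) x y : midpoint x y = midpoint y x.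
Proof.
have [h1 h2] := midpointP bus x y.
have : midpoints y x (midpoint x y) by split; rewrite (metric_sym y x).
by rewrite (midpoints_midpoint bus).
Qed.

(** Replace the endpoints one at a time, passing through [midpoint x y']; each move is one instance
    of the Busemann inequality. *)
Lemma midpoint_dist (bus : busemann_space X) x y x' y' :
  mdist (midpoint x y) (midpoint x' y') <= (mdist x x' + mdist y y') / 2.
Proof.
have h1 := bus.2 _ _ _ _ _ (midpointP bus x y) (midpointP bus x y').
have := bus.2 _ _ _ _ _ (midpointP bus y' x) (midpointP bus y' x').
rewrite !(midpointC bus y') => h2.
have := metric_triangle (midpoint x y) (midpoint x y') (midpoint x' y').
lra.
Qed.

Lemma midpoint_continuous (bus : busemann_space X) :
  continuous (fun p : X * X => midpoint p.1 p.2).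
Proof.
move=> [x y]; apply/metricType_numDomainType.cvgrPdist_lt => e e0.
exists ([set z | mdist z x < e], [set z | mdist z y < e]).
  by split; exact: nbhs_mdist_lt.
move=> [x' y'] /= [xx' yy']; have := midpoint_dist bus x y x' y'.
by rewrite (metric_sym x) (metric_sym y); lra.
Qed.

(** The factor one half is decisive: it gives the penalty the same slope bound in an endpoint as
    half the penalty has in [z]. *)
Lemma dist_midpoint_lipschitz (bus : busemann_space X) z y x x' :
  `|mdist z (midpoint x y) - mdist z (midpoint x' y)| <= 2^-1 * mdist x x'.
Proof.
have := midpoint_dist bus x y x' y; rewrite mdistxx addr0.
have := metric_triangle z (midpoint x y) (midpoint x' y).
have := metric_triangle z (midpoint x' y) (midpoint x y).
rewrite (metric_sym (midpoint x' y)) ler_norml => *.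
by apply/andP; split; lra.
Qed.

End midpoints.

Section positive_times.
Context {R : realType} (X : metricType R).
Implicit Types (x y z : X) (v u : X * R -> R).

(** Freezing [v] at time 0 for negative times gives continuity on all of [X * R], the form in which
    the perturbed maximum principle is applied. *)
Definition time_clamp v : X * R -> R := fun p => v (p.1, Num.max p.2 0).

Lemma time_clampE v x (t : R) : 0 <= t -> time_clamp v (x, t) = v (x, t).
Proof. by move=> t0; rewrite /time_clamp /= max_l. Qed.

Lemma time_clamp_continuous v :
  {within [set p : X * R | 0 <= p.2], continuous v} ->
  continuous (time_clamp v).
Proof.
move=> cv.
have c1 : continuous (fun p : X * R => p.1) by move=> p; exact: cvg_fst.
have c2 : continuous (fun p : X * R => Num.max p.2 0).
  move=> p; apply: (@continuous_max _ _ (fun q : X * R => q.2) (fun=> 0)).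
    exact: cvg_snd.
  exact: cvg_cst.
have cr := pair_continuous c1 c2.
apply: (continuous_within_comp cv cr) => p /=.
by rewrite le_max lexx orbT.
Qed.

(** Crossing the barrier yields an approximate maximum with unit perturbation. Its time is interior:
    [init] excludes time 0, and the decay [M - s] excludes a large final time [T]. *)
Lemma barrier_max v x0 x (A C K t0 : R) :
  complete_space X ->
  {within [set p : X * R | 0 <= p.2], continuous v} ->
  0 <= C -> C <= A -> C + 1 <= K ->
  (forall y t, 0 <= t -> v (y, t) <= C * (mdist x0 y + t + 1)) ->
  (forall y, v (y, 0) <= v (x, 0) + A * mdist y x) ->
  0 <= t0 -> v (x, 0) + K * t0 < v (x, t0) ->
  exists z t T, 0 < t < T /\ forall y s, 0 <= s <= T ->
    v (y, s) - A * mdist y x - K * s <=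
    v (z, t) - A * mdist z x - K * t + mdist y z.
Proof.
move=> cX cv C0 CA CK growth init t00 above.
pose M := C * (mdist x0 x + 1).
have bound y s : 0 <= s -> v (y, s) - A * mdist y x - K * s <= M - s.
  move=> s0; have := growth y s s0; rewrite /M.
  have := ler_wpM2l C0 (metric_triangle x0 x y); rewrite (metric_sym x y).
  have := ler_wpM2r (mdist_ge0 y x) CA; have := ler_wpM2r s0 CK; nra.
pose T := t0 + 1 + `|M - v (x, 0)|.
have T_gt : M - T < v (x, 0) by have := ler_norm (M - v (x, 0)); rewrite /T; lra.
have T0 : t0 <= T by have := normr_ge0 (M - v (x, 0)); rewrite /T; lra.
pose Phi (q : X * R) := time_clamp v q - A * mdist q.1 x - K * q.2.
have [||q||z [t [/= tT max0 maxP]]] := @perturbed_max R X R (@mdist R X) `[0, T]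
  Phi M 1 x t0 (complete_dist_mdist cX) (@segment_compact R 0 T).
- by rewrite /= in_itv /= t00.
- move=> q; apply: cvgB.
    apply: cvgB; first exact: time_clamp_continuous.
    by apply: cvgMr; apply: cvg_mdist; [exact: cvg_fst|exact: cvg_cst].
  by apply: cvgMr; exact: cvg_snd.
- move=> s; rewrite /= in_itv /= => /andP[s0 _].
  by rewrite /Phi time_clampE//=; have := bound q s s0; lra.
- exact: ltr01.
move: tT; rewrite in_itv /= => /andP[t_ge0 t_leT].
move: max0; rewrite /Phi !time_clampE//= mdistxx => max0.
exists z, t, T; split.
  apply/andP; split; rewrite lt_neqAle ?t_ge0 ?t_leT andbT; apply/eqP => tE.
    by move: max0; rewrite -tE; have := init z; lra.
  by move: max0; rewrite tE; have := bound z T ltac:(lra); lra.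
move=> y s /andP[s0 sT].
have := maxP y s; rewrite /Phi in_itv /= s0 sT !time_clampE// => /(_ isT); lra.
Qed.

Lemma initial_rate (H : R -> R) u x0 :
  complete_space X -> geodesic_space X ->
  (forall p q : R, 0 <= p -> p <= q -> H p <= H q) ->
  lipschitz_continuous (fun x => u (x, 0)) ->
  {within [set p : X * R | 0 <= p.2], continuous u} ->
  linear_growth x0 u -> viscosity_solution H u ->
  exists2 K, 0 <= K & forall x t, 0 <= t -> `|u (x, t) - u (x, 0)| <= K * t.
Proof.
move=> cX geo H_mono [L uL] cu [C uC] [sub super].
pose A := `|L| + `|C|.
have A0 : 0 <= A by rewrite addr_ge0.
(* The barrier plus the unit perturbation has slope at most [A + 1]. With this rate [K], a crossing
   from below violates the supersolution test through [H (A + 1)], and one from above the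
   subsolution test through [H 0]. *)
pose K := `|C| + 1 + `|H 0| + `|H (A + 1)|.
have HK0 := normr_ge0 (H 0); have HK1 := normr_ge0 (H (A + 1)).
have CK : `|C| + 1 <= K by rewrite /K; lra.
have CA : `|C| <= A by rewrite /A lerDr.
have growth y t : 0 <= t -> `|u (y, t)| <= `|C| * (mdist x0 y + t + 1).
  move=> t0; apply: le_trans (uC y t t0) _; rewrite ler_wpM2r ?ler_norm//.
  by have := mdist_ge0 x0 y; lra.
have init x y : `|u (y, 0) - u (x, 0)| <= A * mdist y x.
  apply: le_trans (uL y x) _; rewrite ler_wpM2r ?mdist_ge0//.
  by rewrite /A; have := ler_norm L; have := normr_ge0 C; lra.
have g_lip x z y : lip_at (fun w => A * mdist w x + 1 * mdist w z) y (A + 1).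
  apply: (lip_atD (g1 := fun w => A * mdist w x) (g2 := fun w => 1 * mdist w z)).
    exact: lip_at_dist.
  exact: lip_at_dist.
exists K => [|x t t0]; first by rewrite /K; have := normr_ge0 C; lra.
rewrite ler_norml; apply/andP; split; rewrite leNgt; apply/negP => above.
- have [||||z [s [T [sT maxP]]]] := @barrier_max (\- u) x0 x A `|C| K t cX
    _ (normr_ge0 C) CA CK _ _ t0.
  + by move=> p; apply: cvgN; exact: cu.
  + move=> y r r0 /=; apply: le_trans (growth y r r0).
    by rewrite -normrN ler_norm.
  + move=> y /=; have := init x y; rewrite ler_norml => /andP[]; lra.
  + rewrite /=; lra.
  have : 0 <= 2 * 0 * s + - K + H (A + 1).
    apply: (@supersolution_at_min R X H u
      (\- (fun w => A * mdist w x + 1 * mdist w z)) 0 (- K) z s (A + 1) T) => //.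
    + lra.
    + by move=> y; exists (A + 1); apply: lip_atN; exact: g_lip.
    + by apply: lip_atN; exact: g_lip.
    + by move=> y r rT; have := maxP y r rT; rewrite /= mdistxx; lra.
  by have := ler_norm (H (A + 1)); have := normr_ge0 C; rewrite /K; lra.
have [|||z [s [T [sT maxP]]]] := @barrier_max u x0 x A `|C| K t cX
    cu (normr_ge0 C) CA CK _ _ t0.
- by move=> y r r0 /=; apply: le_trans (growth y r r0); exact: ler_norm.
- by move=> y /=; have := init x y; rewrite ler_norml => /andP[]; lra.
- lra.
have : 2 * 0 * s + K + H (Num.max (2 * 0 * mdist z x - (A + 1)) 0) <= 0.
  (* The coefficient 0 makes [psi1] vanish, so the truncated argument of [H] is 0. *)
  apply: (@subsolution_at_max R X H u 0 x
    (fun w => A * mdist w x + 1 * mdist w z) 0 K z s (A + 1) T) => //.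
  - lra.
  - by move=> y; exists (A + 1); exact: g_lip.
  - by move=> y r rT; have := maxP y r rT; rewrite mdistxx; lra.
rewrite !mulr0 !mul0r add0r max_r; last by lra.
have := ler_norm (- H 0); rewrite normrN; have := normr_ge0 C.
by rewrite /K; lra.
Qed.

End positive_times.

(** * The penalized convexity defect *)

(** In the increasing penalty, the linear parts give a strict gain in the time derivatives and the
    squares dominate the growth [K * t]. The weight 2 at [t] matches that of [u (z, t)]. *)
Definition penalized_defect (R : realType) (X : metricType R) (u : X * R -> R)
    (A B sg : R) (z x y : X) (t s r : R) : R :=
  2 * u (z, t) - u (x, s) - u (y, r) - A * mdist z (midpoint x y) ^+ 2
  - B * ((t - s) ^+ 2 + (t - r) ^+ 2)
  - sg * (2 * (t + t ^+ 2) + (s + s ^+ 2) + (r + r ^+ 2)).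

Lemma penalized_defect_continuous (R : realType) (X : metricType R)
    (v : X * R -> R) (A B sg : R) :
  busemann_space X -> continuous v ->
  continuous (fun q : (X * X * X) * (R * R * R) =>
    penalized_defect v A B sg q.1.1.1 q.1.1.2 q.1.2 q.2.1.1 q.2.1.2 q.2.2).
Proof.
move=> bus cv; set W := ((X * X * X) * (R * R * R))%type.
have cid : continuous (@id W) by move=> q; exact: cvg_id.
have c1 := continuous_fst cid; have c2 := continuous_snd cid.
have c11 := continuous_fst c1; have cy := continuous_snd c1.
have cz := continuous_fst c11; have cx := continuous_snd c11.
have c21 := continuous_fst c2; have cr := continuous_snd c2.
have ct := continuous_fst c21; have cs := continuous_snd c21.
have cvz := continuous_compose cv (pair_continuous cz ct).
have cvx := continuous_compose cv (pair_continuous cx cs).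
have cvy := continuous_compose cv (pair_continuous cy cr).
have cm := continuous_compose (midpoint_continuous bus) (pair_continuous cx cy).
have cX (f : W -> R) : continuous f -> continuous (fun q => f q ^+ 2).
  by move=> cf q; exact: (cvgM (cf q) (cf q)).
have cP (f : W -> R) : continuous f -> continuous (fun q => f q + f q ^+ 2).
  by move=> cf q; apply: cvgD; [exact: cf|exact: cX].
have cd : continuous (fun q : W => mdist q.1.1.1 (midpoint q.1.1.2 q.1.2)).
  by move=> q; apply: cvg_mdist; [exact: cz|exact: cm].
have cts : continuous (fun q : W => q.2.1.1 - q.2.1.2).
  by move=> q; apply: cvgB; [exact: ct|exact: cs].
have ctr : continuous (fun q : W => q.2.1.1 - q.2.2).
  by move=> q; apply: cvgB; [exact: ct|exact: cr].
move=> q; apply: cvgB; last first.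
  apply: cvgMr; apply: cvgD; last exact: (cP _ cr).
  by apply: cvgD; [apply: cvgMr; exact: (cP _ ct)|exact: (cP _ cs)].
apply: cvgB; last first.
  by apply: cvgMr; apply: cvgD; [exact: (cX _ cts)|exact: (cX _ ctr)].
apply: cvgB; last by apply: cvgMr; exact: (cX _ cd).
apply: cvgB; last exact: cvy.
by apply: cvgB; [apply: cvgMr; exact: cvz|exact: cvx].
Qed.

(** The quadratic in [w] peaks at the value [b ^+ 2 / a]. *)
Lemma completed_square_le (R : realType) (a b e w : R) :
  0 < a -> b ^+ 2 <= a * e -> 2 * b * w - a * w ^+ 2 <= e.
Proof.
move=> a0 be; rewrite -(ler_pM2l a0); have := sqr_ge0 (b - a * w).
by rewrite sqrrB exprMn; lra.
Qed.

Section convexity_defect.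
Context {R : realType} (X : metricType R) (u : X * R -> R).

Lemma initial_defect_le L :
  busemann_space X ->
  (forall x y, `|u (x, 0) - u (y, 0)| <= L * mdist x y) ->
  (forall x y, 2 * u (midpoint x y, 0) <= u (x, 0) + u (y, 0)) ->
  forall z x y,
    2 * u (z, 0) - u (x, 0) - u (y, 0) <= 2 * L * mdist z (midpoint x y).
Proof.
move=> bus uL conv z x y.
have := uL z (midpoint x y); rewrite ler_norml => /andP[_].
by have := conv x y; lra.
Qed.

(** All constants, including the slope bound [P], are chosen before [d], so the perturbation can
    later be adapted to the modulus of continuity of [H] on [[0, P]]. *)
Lemma penalized_defect_max L K x0 y0 t0 th :
  complete_space X -> busemann_space X ->
  {within [set p : X * R | 0 <= p.2], continuous u} ->
  (forall x y, `|u (x, 0) - u (y, 0)| <= L * mdist x y) ->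
  (forall x y, 2 * u (midpoint x y, 0) <= u (x, 0) + u (y, 0)) ->
  0 <= K -> (forall x t, 0 <= t -> `|u (x, t) - u (x, 0)| <= K * t) ->
  0 <= t0 -> 0 < th ->
  th <= 2 * u (midpoint x0 y0, t0) - u (x0, t0) - u (y0, t0) ->
  exists A B sg T P, [/\ 0 < A, 0 < sg & forall d, 0 < d ->
    exists z x y t s r, [/\ 0 < t < T, 0 < s < T & 0 < r < T] /\
    A * mdist z (midpoint x y) <= P /\
    forall z' x' y' t' s' r',
      0 <= t' <= T -> 0 <= s' <= T -> 0 <= r' <= T ->
      penalized_defect u A B sg z' x' y' t' s' r' <=
      penalized_defect u A B sg z x y t s r
      + d * (mdist z' z + mdist x' x + mdist y' y)].
Proof.
move=> cX bus cu uL conv K0 uK t00 th0 th_le.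
have init := initial_defect_le bus uL conv.
(* Of the defect [8 * e], the increasing penalty at [t0] consumes at most [4 * e], while the
   functional is at most [3 * e] when some time vanishes. The coefficients [A] and [B] make each
   completed square cost at most [e]. *)
have [e [e0 eE]] : exists e, 0 < e /\ 8 * e = th by exists (th / 8); split; lra.
have L20 := sqr_ge0 L; have K20 := sqr_ge0 (2 * K).
have solve (a b : R) : 0 < a -> 0 < b -> exists c : R, 0 < c /\ c * a = b.
  by move=> a0 b0; exists (b / a); split; [exact: divr_gt0|rewrite divfK ?gt_eqF].
have [A [A0 Ae]] := solve e (L ^+ 2 + 1) e0 ltac:(lra).
have [B [B0 Be]] := solve e ((2 * K) ^+ 2 + 1) e0 ltac:(lra).
have tt0 : 0 <= t0 + t0 ^+ 2 by rewrite addr_ge0// sqr_ge0.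
have [sg [sg0 sgE]] := solve (8 * (t0 + t0 ^+ 2) + 8) th ltac:(lra) th0.
have [Q [Q0 QE]] := solve sg (K ^+ 2 + 1) sg0 ltac:(have := sqr_ge0 K; lra).
(* The final time is so large that one time equal to [T] outweighs [e] and the at most [3 * Q] from
   the others; the functional is then nonpositive. *)
have [T' [T'0 T'E]] := solve sg (K + e + 3 * Q) sg0 ltac:(lra).
have [T [t0T T1 sgT]] : exists T : R, [/\ t0 <= T, 1 <= T & K + e + 3 * Q <= sg * T].
  exists (t0 + 1 + T'); split; [lra|lra|].
  by have := mulr_ge0 (ltW sg0) t00; lra.
have time_le (t : R) : 0 <= t -> K * t - sg * (t + t ^+ 2) <= Q.
  move=> t_ge0; have := @completed_square_le R sg (K / 2) Q t sg0.
  have -> : (K / 2) ^+ 2 <= sg * Q by have := sqr_ge0 K; lra.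
  by move=> /(_ isT); have := mulr_ge0 (ltW sg0) t_ge0; lra.
have time_T : K * T - sg * (T + T ^+ 2) <= - (e + 3 * Q).
  have h : 0 <= (sg * T - K - e - 3 * Q) * T by rewrite mulr_ge0; lra.
  have h2 : 0 <= (e + 3 * Q) * (T - 1) by rewrite mulr_ge0; lra.
  have h3 : 0 <= sg * T by rewrite mulr_ge0 ?ltW//; lra.
  rewrite expr2; nra.
have uK' x t : 0 <= t -> u (x, 0) - K * t <= u (x, t) <= u (x, 0) + K * t.
  by move=> /(uK x); rewrite ler_norml => /andP[h1 h2]; apply/andP; split; lra.
have sq_le w : 2 * L * w - A * w ^+ 2 <= e.
  by apply: completed_square_le => //; rewrite Ae; lra.
have raw z x y t s r : 0 <= t -> 0 <= s -> 0 <= r ->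
    2 * u (z, t) - u (x, s) - u (y, r) <=
    2 * L * mdist z (midpoint x y) + K * (2 * t + s + r).
  move=> /(uK' z)/andP[_ h1] /(uK' x)/andP[h2 _] /(uK' y)/andP[h3 _].
  have := init z x y; lra.
have pen_ge0 t s r : 0 <= B * ((t - s) ^+ 2 + (t - r) ^+ 2).
  by rewrite mulr_ge0 ?(ltW B0)// addr_ge0// sqr_ge0.
have bound z x y t s r : 0 <= t -> 0 <= s -> 0 <= r ->
    penalized_defect u A B sg z x y t s r <= e +
    (K * t - sg * (t + t ^+ 2)) * 2 + (K * s - sg * (s + s ^+ 2)) +
    (K * r - sg * (r + r ^+ 2)).
  move=> t_ge0 s_ge0 r_ge0; have := raw z x y t s r t_ge0 s_ge0 r_ge0.
  have := sq_le (mdist z (midpoint x y)); have := pen_ge0 t s r.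
  by rewrite /penalized_defect; lra.
have at_zero z x y t s r : 0 <= t -> 0 <= s -> 0 <= r ->
    t = 0 \/ s = 0 \/ r = 0 -> penalized_defect u A B sg z x y t s r <= 3 * e.
  move=> t_ge0 s_ge0 r_ge0 zero; have := raw z x y t s r t_ge0 s_ge0 r_ge0.
  have := sq_le (mdist z (midpoint x y)).
  have sgt (a : R) : 0 <= a -> 0 <= sg * (a + a ^+ 2).
    by move=> a0; rewrite mulr_ge0 ?(ltW sg0)// addr_ge0// sqr_ge0.
  have := sgt _ t_ge0; have := sgt _ s_ge0; have := sgt _ r_ge0.
  have KB a : 2 * (2 * K) * a - B * a ^+ 2 <= e.
    by apply: completed_square_le => //; rewrite Be; lra.
  have := KB `|t - s|; have := KB `|t - r|; rewrite !real_normK ?num_real//.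
  (* If one time vanishes, all times are controlled by their differences, and the [B] penalty
     absorbs the barrier growth. *)
  have : K * (2 * t + s + r) <= K * (4 * (`|t - s| + `|t - r|)).
    rewrite ler_wpM2l//.
    have := ler_norm (t - s); have := ler_norm (t - r).
    have := ler_norm (s - t); have := ler_norm (r - t).
    rewrite !(distrC _ t); case: zero => [|[|]] ->; lra.
  by rewrite /penalized_defect; lra.
exists A, B, sg, T, (2 * e + 4 * Q + A / 2); split=> // d d0.
pose D : X * X * X -> X * X * X -> R :=
  fun p q => mdist p.1.1 q.1.1 + mdist p.1.2 q.1.2 + mdist p.2 q.2.
have cD : complete_dist D.
  have cX1 := complete_dist_mdist cX.
  exact: (complete_dist_prod (complete_dist_prod cX1 cX1) cX1).
pose Phi (q : (X * X * X) * (R * R * R)) :=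
  penalized_defect (time_clamp u) A B sg
    q.1.1.1 q.1.1.2 q.1.2 q.2.1.1 q.2.1.2 q.2.2.
have PhiE z x y t s r : 0 <= t -> 0 <= s -> 0 <= r ->
    Phi ((z, x, y), (t, s, r)) = penalized_defect u A B sg z x y t s r.
  by move=> t1 s1 r1; rewrite /Phi /penalized_defect !time_clampE.
have cPhi : continuous Phi.
  by apply: penalized_defect_continuous => //; exact: time_clamp_continuous.
have [||[[z x] y] [[[t s] r] [/= [[+ +] +] max0 maxP]]] :=
  @perturbed_max R (X * X * X)%type (R * R * R)%type D
    ((`[0, T] `*` `[0, T]) `*` `[0, T])%classic Phi (e + 4 * Q) d
    (midpoint x0 y0, x0, y0) (t0, t0, t0) cD
    (compact_setX (compact_setX (@segment_compact R 0 T) (@segment_compact R 0 T))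
       (@segment_compact R 0 T)) _ cPhi _ d0.
- by rewrite /= in_itv /= t00.
- move=> [[z x] y] [[t s] r] /= [[+ +] +]; rewrite !in_itv /=.
  move=> /andP[t1 _] /andP[s1 _] /andP[r1 _]; rewrite PhiE//.
  have := bound z x y t s r t1 s1 r1.
  have := time_le _ t1; have := time_le _ s1; have := time_le _ r1; lra.
rewrite !in_itv /= => /andP[t1 tT] /andP[s1 sT] /andP[r1 rT].
move: max0; rewrite !PhiE// => max0.
have {max0} pos : 4 * e <= penalized_defect u A B sg z x y t s r.
  apply: le_trans max0; rewrite /penalized_defect mdistxx !subrr expr0n /=.
  by have := sgE; have := sg0; lra.
have bnd := bound z x y t s r t1 s1 r1.
have tq := time_le _ t1; have sq := time_le _ s1; have rq := time_le _ r1.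
have inside a : a = t \/ a = s \/ a = r -> 0 < a < T.
  move=> atsr; have [a0 aT] : 0 <= a /\ a <= T by case: atsr => [|[|]] ->.
  rewrite !lt_neqAle a0 aT !andbT; apply/andP; split; apply/eqP => aE.
    have zero : t = 0 \/ s = 0 \/ r = 0.
      by move: atsr; rewrite -aE => -[|[|]] <-; auto.
    by have := at_zero z x y t s r t1 s1 r1 zero; lra.
  by move: atsr; rewrite aE => -[|[|]] TE; move: time_T; rewrite TE; lra.
exists z, x, y, t, s, r; split; first by split; apply: inside; tauto.
split.
  (* Positivity of the functional, with half of the quadratic absorbing [2 * L * w], gives
     [A / 2 * w ^+ 2 <= 2 * e + 4 * Q]; then [2 * w <= w ^+ 2 + 1] yields the bound [P]. *)
  set w := mdist z (midpoint x y).
  have w1 := sqr_ge0 (w - 1).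
  have h : 2 * L * w - A / 2 * w ^+ 2 <= 2 * e.
    by apply: completed_square_le; lra.
  have h2 : 0 <= 2 * L * w - A * w ^+ 2 + 4 * Q.
    have := raw z x y t s r t1 s1 r1; have := pen_ge0 t s r.
    by move: pos; rewrite /penalized_defect -/w; lra.
  have : 0 <= A / 2 * (w - 1) ^+ 2 by rewrite mulr_ge0//; lra.
  by rewrite sqrrB1; lra.
move=> z' x' y' t' s' r' /andP[t'0 t'T] /andP[s'0 s'T] /andP[r'0 r'T].
have := maxP (z', x', y') (t', s', r'); rewrite !PhiE//; apply.
by rewrite /= !in_itv /= t'0 t'T s'0 s'T r'0 r'T.
Qed.

End convexity_defect.

(** * The contradiction at an approximate maximum *)

Unset Implicit Arguments.
Set Strict Implicit.
Set Printing Implicit Defensive.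

Theorem theorem1p1 (R : realType) (X : metricType R) (H : R -> R)
    (u0 : X -> R) (x0 : X) (u : X * R -> R) :
  complete_space X ->
  busemann_space X ->
  {within [set p : R | 0 <= p], continuous H} ->
  (forall p q : R, 0 <= p -> p <= q -> H p <= H q) ->
  lipschitz_continuous u0 ->
  {within [set p : X * R | 0 <= p.2], continuous u} ->
  linear_growth x0 u ->
  viscosity_solution H u ->
  (forall x, u (x, 0) = u0 x) ->
  geodesically_convex u0 ->
  forall t : R, 0 <= t -> geodesically_convex (fun x => u (x, t)).
Proof.
move=> cX bus cH H_mono u0_lip cu growth sol uE [_ u0_conv] tt tt0; split.
  have cr : continuous (fun x : X => (x, tt)).
    by apply: pair_continuous => x; [exact: cvg_id|exact: cvg_cst].
  exact: (continuous_within_comp cu cr).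
move=> xx yy; rewrite leNgt; apply/negP => defect.
have geo := bus.1.
have uE0 : (fun x => u (x, 0)) = u0 by apply/funext.
have [L uL] := u0_lip.
have [K K0 uK] : exists2 K, 0 <= K &
    forall x t, 0 <= t -> `|u (x, t) - u (x, 0)| <= K * t.
  by apply: (initial_rate cX geo H_mono _ cu growth sol); rewrite uE0.
have [sub super] := sol.
have [||A [B [sg [T [P [A0 sg0 maxP]]]]]] := @penalized_defect_max R X u L K xx yy
  tt (2 * u (midpoint xx yy, tt) - u (xx, tt) - u (yy, tt)) cX bus cu _ _ K0 uK
  tt0 ltac:(lra) (lexx _).
- by move=> x y; rewrite !uE.
- by move=> x y; rewrite !uE.
have [d d0 dP] := uniform_increment P cH sg0.
have [z [x [y [t [s [r [[tT sT rT] [AP {}maxP]]]]]]]] := maxP d d0.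
have closed a : 0 < a < T -> 0 <= a <= T by move=> /andP[/ltW -> /ltW ->].
set w := mdist z (midpoint x y) in AP.
have w0 : 0 <= w := mdist_ge0 _ _.
have Aw0 : 0 <= A * w by rewrite mulr_ge0// ltW.
(* Since [u (z, t)] enters with factor 2, the functional is halved before testing, whence [A / 2]
   and [d / 2]. *)
have at_z : 2 * (B + sg) * t + (sg - B * (s + r)) +
    H (Num.max (2 * (A / 2) * w - d / 2) 0) <= 0.
  apply: (@subsolution_at_max R X H u (A / 2) (midpoint x y)
    (fun z' => d / 2 * mdist z' z) _ _ z t (d / 2) T) => //; [lra|lra| | |].
  - by move=> z'; exists (d / 2); apply: lip_at_dist; lra.
  - by apply: lip_at_dist; lra.
  move=> z' t' t'T; have := maxP z' x y t' s r t'T (closed _ sT) (closed _ rT).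
  by rewrite /penalized_defect !mdistxx -/w; lra.
have lip_mid y' x' : lip_at (fun x1 => A * mdist z (midpoint x1 y') ^+ 2) x'
    (A * mdist z (midpoint x' y')).
  have := @lip_at_sqr R X (fun x1 => mdist z (midpoint x1 y')) A 2^-1 x' (ltW A0).
  rewrite (_ : 2 * A * 2^-1 = A); last by rewrite mulrAC divff ?mul1r.
  apply; first by rewrite invr_ge0.
    by move=> x1; exact: mdist_ge0.
  by move=> x1 x2; exact: dist_midpoint_lipschitz.
have lip_pen y' c x' : lip_at
    (\- (fun x1 => A * mdist z (midpoint x1 y') ^+ 2 + d * mdist x1 c)) x'
    (A * mdist z (midpoint x' y') + d).
  apply: lip_atN; apply: (lip_atD (lip_mid y' x')).
  by apply: lip_at_dist; lra.
have at_x : 0 <= 2 * - (B + sg) * s + (2 * B * t - sg) + H (A * w + d).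
  apply: (@supersolution_at_min R X H u
    (\- (fun x1 => A * mdist z (midpoint x1 y) ^+ 2 + d * mdist x1 x))
    _ _ x s _ T) => //; first lra.
  - by move=> x'; exists (A * mdist z (midpoint x' y) + d).
  move=> x' s' s'T; have := maxP z x' y t s' r (closed _ tT) s'T (closed _ rT).
  by rewrite /penalized_defect /= !mdistxx -/w; lra.
(* Symmetry of the midpoint reduces this to the estimate in the first endpoint. *)
have at_y : 0 <= 2 * - (B + sg) * r + (2 * B * t - sg) + H (A * w + d).
  rewrite /w (midpointC bus x y).
  apply: (@supersolution_at_min R X H u
    (\- (fun y1 => A * mdist z (midpoint y1 x) ^+ 2 + d * mdist y1 y))
    _ _ y r _ T) => //.
  - by rewrite (midpointC bus y x) -/w; lra.
  - by move=> y'; exists (A * mdist z (midpoint y' x) + d).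
  move=> y' r' r'T; have := maxP z x y' t s r' (closed _ tT) (closed _ sT) r'T.
  rewrite /penalized_defect /= !mdistxx (midpointC bus y x).
  by rewrite (midpointC bus y' x); lra.
have H_le : H (Num.max (A * w - d) 0) <= H (Num.max (2 * (A / 2) * w - d / 2) 0).
  apply: H_mono; first by rewrite le_max lexx orbT.
  by rewrite ge_max !le_max lexx orbT andbT; apply/orP; left; lra.
(* In [at_x] plus [at_y] minus twice [at_z] the [B] terms cancel. What remains forces an increment
   of [H] of at least [2 * sg], whereas [d] was chosen to keep it below [sg]. *)
have := dP (A * w); rewrite Aw0 AP => /(_ isT).
have : 0 <= sg * t + sg * t + sg * s + sg * r.
  by case/andP: tT sT rT => ? _ /andP[? _] /andP[? _]; rewrite !addr_ge0// mulr_ge0// ltW.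
lra.
Qed.
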